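(* Let $N\ge 1$ be an integer and let $y_1,\dots,y_N\in\mathbb{R}\setminus\{0\}$ satisfy $|y_1|\le |y_2|\le\cdots\le |y_N|$. Let $p$ be the number of indices $i$ with $y_i>0$ and $m$ the number of indices $i$ with $y_i<0$ (so $p+m=N$). Then $$\prod_{1\le i<j\le N}\left|1-\frac{y_i}{y_j}\right|\le 2^{\min(p,m)}.$$ In particular, $$\prod_{1\le i<j\le N}\left|1-\frac{y_i}{y_j}\right|\le 2^{\lfloor N/2\rfloor}.$$
   Context: An empty product (the case $N=1$) equals $1$. *)

(* Defs.v *)
From mathcomp Require Import all_boot all_order all_algebra.
From mathcomp Require Import reals.

(* Main.v *)
(** With [q(u, v) = |u - v| / max(|u|, |v|)], the product is that of [q(y_i, y_j)]
    over unordered pairs, so the ordering hypothesis disappears.  Multiply all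
    positive [y_i] by [expR t].  Only factors of opposite sign change, and between
    two consecutive ties [y_i = - y_j] each of them is a log-convex function of [t].
    Hence the product does not decrease when [t] moves to the next tie in the
    direction given by the sign of the logarithmic derivative.  At a tie
    [y_l = - y_k], removing [k] and [l] costs a factor at most 2, because
    [q(y_k, - y_k) = 2] and [q(u, y_k) q(u, - y_k) <= 1]; conclude by induction. *)

Require Import Defs.
From mathcomp Require Import all_boot all_order all_algebra.
From mathcomp Require Import reals.
From mathcomp Require Import sequences exp.
From mathcomp Require Import ring lra zify.

Set Implicit Arguments.
Unset Strict Implicit.
Unset Printing Implicit Defensive.

Import Order.TTheory GRing.Theory Num.Theory.
Local Open Scope ring_scope.

(** * Relative distance of two reals *)

Section RelativeDistance.
Variable R : realType.
Implicit Types u v a b t : R.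

Definition reldist u v := `|u - v| / Num.max `|u| `|v|.

Lemma reldistC u v : reldist u v = reldist v u.
Proof. by rewrite /reldist distrC maxC. Qed.

Lemma reldistNN u v : reldist (- u) (- v) = reldist u v.
Proof. by rewrite /reldist !normrN -opprD normrN. Qed.

Lemma reldist_ge0 u v : 0 <= reldist u v.
Proof. by rewrite divr_ge0 // le_max normr_ge0. Qed.

Lemma reldist_norm_le u v : v != 0 -> `|u| <= `|v| -> reldist u v = `|1 - u / v|.
Proof.
move=> v0 uv; rewrite /reldist max_r // -normf_div.
by rewrite mulrBl divff // distrC.
Qed.

Lemma reldist_same_sign u v : u != 0 -> v != 0 -> (0 < u) = (0 < v) ->
  reldist u v <= 1.
Proof.
wlog uv : u v / `|u| <= `|v|.
  move=> H u0 v0 E; have [|/ltW] := leP `|u| `|v|; first by move/H; apply.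
  by rewrite reldistC; move/H; apply.
move=> u0 v0 E; rewrite /reldist max_r // ler_pdivrMr ?normr_gt0 // mul1r.
have [v_gt0|v_le0] := ltP 0 v.
  rewrite v_gt0 in E; rewrite (gtr0_norm v_gt0) (gtr0_norm E) in uv *.
  rewrite ler_norml; lra.
have v_lt0 : v < 0 by rewrite lt_neqAle v0.
have u_lt0 : u < 0 by rewrite lt_neqAle u0 leNgt E -leNgt.
rewrite (ltr0_norm v_lt0) (ltr0_norm u_lt0) in uv *.
rewrite ler_norml; lra.
Qed.

Lemma reldist_opp v : v != 0 -> reldist v (- v) = 2.
Proof.
move=> v0; rewrite /reldist normrN maxxx opprK -mulr2n normrMn.
by rewrite mulrnAl divff // normr_eq0.
Qed.

(** The product equals |u^2 - v^2| / M^2 with M = max(|u|, |v|), and both squares lie in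
    [0, M^2]. *)
Lemma reldistM_opp u v : v != 0 -> reldist u v * reldist u (- v) <= 1.
Proof.
move=> v0; rewrite /reldist normrN mulf_div -normrM opprK -subr_sqr.
set M := Num.max _ _.
have M_gt0 : 0 < M by rewrite lt_max !normr_gt0 v0 orbT.
rewrite ler_pdivrMr ?mulr_gt0 // mul1r -expr2.
have sqr_leM w : `|w| <= M -> w ^+ 2 <= M ^+ 2.
  by rewrite -(real_normK (num_real w)) ler_sqr ?nnegrE // ltW.
have uM : u ^+ 2 <= M ^+ 2 by rewrite sqr_leM // le_max lexx.
have vM : v ^+ 2 <= M ^+ 2 by rewrite sqr_leM // le_max lexx orbT.
have := sqr_ge0 u; have := sqr_ge0 v; rewrite ler_norml; lra.
Qed.

(** * Scaling the positive entries: slopes and the tangent bound *)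

Definition scale_pos t u := if 0 < u then expR t * u else u.

Lemma scale_pos_gt0 t u : (0 < scale_pos t u) = (0 < u).
Proof.
by rewrite /scale_pos; case: ifP => // u0; rewrite pmulr_rgt0 ?expR_gt0.
Qed.

Lemma scale_pos_neq0 t u : u != 0 -> scale_pos t u != 0.
Proof.
rewrite /scale_pos; case: ifP => // _ u0.
by rewrite mulf_neq0 // gt_eqF ?expR_gt0.
Qed.

(* The derivative at [t = 0] of [ln (reldist (scale_pos t u) (scale_pos t v))],
   away from the ties [u = - v]. *)
Definition slope u v :=
  if 0 < u * v then 0
  else (if u + v < 0 then Num.max u v else Num.min u v) / `|u - v|.

Lemma slopeC u v : slope u v = slope v u.
Proof. by rewrite /slope mulrC addrC maxC minC distrC. Qed.

(** At a tie both [slope u v] and [slope (- u) (- v)] take the [min] branch and coincide, so oddness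
    has to exclude ties. *)
Lemma slopeNN u v : (u * v < 0 -> u + v != 0) -> u * v != 0 ->
  slope (- u) (- v) = - slope u v.
Proof.
move=> tie uv0; rewrite /slope mulrNN; case: ltP => [_|uv]; first by rewrite oppr0.
rewrite -mulNr -!opprD normrN oppr_lt0.
have uv_lt0 : u * v < 0 by rewrite lt_neqAle uv0.
by have [s|s|s] := ltgtP (u + v) 0; rewrite ?oppr_min ?oppr_max //;
  move: (tie uv_lt0); rewrite s eqxx.
Qed.

(* Tangent line at [t = 0] of the convex function [t |-> ln (expR t * a + b)]. *)
Lemma expR_tangent a b t : 0 < a -> 0 < b ->
  (a + b) * expR (t * (a / (a + b))) <= expR t * a + b.
Proof.
move=> a0 b0; have ab0 : 0 < a + b by rewrite addr_gt0.
set m := t * _; rewrite -(ler_pM2r (expR_gt0 (- m))) -mulrA -expRD subrr expR0 mulr1.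
rewrite mulrDl mulrAC -expRD.
(* With this [m], the lower bounds 1 + x of [expR x] at t - m and - m, weighted by [a] and [b], add
   up to exactly a + b. *)
have m_def : m * (a + b) = t * a by rewrite /m -mulrA divfK // gt_eqF.
have H1 := expR_ge1Dx (t - m); have H2 := expR_ge1Dx (- m).
have K1 : (1 + (t - m)) * a <= expR (t - m) * a by rewrite ler_pM2r.
have K2 : b * (1 - m) <= b * expR (- m) by rewrite ler_pM2l.
apply: le_trans (lerD K1 K2); lra.
Qed.

(** For opposite signs, the last two hypotheses prevent the positive entry from overtaking a
    negative one of larger modulus. The denominator is then either constant or multiplied by
    [expR t], and [expR_tangent] bounds the numerator. *)
Lemma reldist_scale_pos_ge t u v : u != 0 -> v != 0 -> 0 <= t ->
    (u * v < 0 -> u + v != 0) ->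
    (0 < u -> u + v < 0 -> expR t * u + v <= 0) ->
    (0 < v -> u + v < 0 -> u + expR t * v <= 0) ->
  reldist u v * expR (t * slope u v) <= reldist (scale_pos t u) (scale_pos t v).
Proof.
wlog vu : u v / v <= u.
  move=> H u0 v0 t0 tie cu cv; have [|/ltW uv] := leP v u; first by move/H; apply.
  rewrite reldistC slopeC [leRHS]reldistC; apply: H => //.
  - by rewrite mulrC addrC.
  - by rewrite [v + u]addrC [_ + u]addrC.
  - by rewrite [v + u]addrC [v + _]addrC.
move=> u0 v0 t0 tie cu _.
have e_gt0 := expR_gt0 t.
have [uv|uv] := ltP 0 (u * v).
  (* Both entries are scaled or neither is, and [reldist] is homogeneous of degree 0. *)
  rewrite /slope uv mulr0 expR0 mulr1 /scale_pos.
  have [u_gt0|u_le0] := ltP 0 u; last by rewrite ltNge (le_trans vu).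
  have v_gt0 : 0 < v by rewrite -(pmulr_rgt0 _ u_gt0).
  rewrite v_gt0 /reldist -mulrBr !normrM -maxr_pMr // (gtr0_norm e_gt0).
  by rewrite invfM mulrACA divff ?mul1r // gt_eqF.
have uv_lt0 : u * v < 0 by rewrite lt_neqAle mulf_neq0.
have [v_lt0 u_gt0] : v < 0 /\ 0 < u by split; nra.
rewrite /slope (ltNge 0) uv /= /scale_pos u_gt0 (ltNge 0 v) (ltW v_lt0) /= /reldist.
have eu_gt0 : 0 < expR t * u by rewrite mulr_gt0.
rewrite (gtr0_norm u_gt0) (ltr0_norm v_lt0) (gtr0_norm eu_gt0) (max_l vu) (min_r vu).
have := @expR_tangent u (- v) t u_gt0; rewrite oppr_gt0 => /(_ v_lt0) tangent.
rewrite (gtr0_norm (_ : 0 < u - v)) ?(gtr0_norm (_ : 0 < expR t * u - v)); try lra.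
have [s_lt0|s_ge0] := ltP (u + v) 0.
  have := cu u_gt0 s_lt0 => eu.
  rewrite !max_r; try lra.
  by rewrite mulrAC ler_pM2r // invr_gt0; lra.
have e_ge1 : 1 <= expR t by have := expR_ge1Dx t; lra.
have u_le : u <= expR t * u by rewrite ler_peMl // ltW.
rewrite !max_l; try lra.
(* The positive entry dominates: the - t in the exponent is the growth of the denominator by
   [expR t]. *)
have -> : t * (v / (u - v)) = t * (u / (u - v)) - t by field; lra.
rewrite expRD expRN mulrACA -invfM [u * expR t]mulrC.
by rewrite ler_pM2r // invr_gt0.
Qed.

End RelativeDistance.

(** * The squared product over a set of indices *)

Section SquaredProduct.
Variables (R : realType) (I : finType).
Implicit Types (y : I -> R) (S : {set I}).

(* The diagonal factors are 1 so that both indices range over all of [S]; every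
   unordered pair then occurs twice, and [sqprod] is the square of the product
   in the theorem. *)
Definition pair_factor y i j := if i == j then 1 else reldist (y i) (y j).

Definition sqprod y S := \prod_(i in S) \prod_(j in S) pair_factor y i j.

Definition npos y S := #|[set i in S | 0 < y i]|.
Definition nneg y S := #|[set i in S | y i < 0]|.

Lemma pair_factorC y i j : pair_factor y i j = pair_factor y j i.
Proof. by rewrite /pair_factor eq_sym reldistC. Qed.

Lemma pair_factor_ge0 y i j : 0 <= pair_factor y i j.
Proof. by rewrite /pair_factor; case: ifP => // _; exact: reldist_ge0. Qed.

Lemma sqprodU1 y k S : k \notin S ->
  sqprod y (k |: S) = (\prod_(j in S) pair_factor y k j) ^+ 2 * sqprod y S.
Proof.
move=> kS; rewrite /sqprod big_setU1 //= big_setU1 //= {1}/pair_factor eqxx mul1r.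
rewrite expr2 -mulrA; congr (_ * _); rewrite -big_split /=.
by apply: eq_bigr => i iS; rewrite big_setU1 //= pair_factorC.
Qed.

Lemma sqprod_opp y S : sqprod (fun i => - y i) S = sqprod y S.
Proof.
apply: eq_bigr => i _; apply: eq_bigr => j _.
by rewrite /pair_factor reldistNN.
Qed.

Lemma sqprod_ge0 y S : 0 <= sqprod y S.
Proof. by do 2!(apply: prodr_ge0 => ? _); exact: pair_factor_ge0. Qed.

(** The pair {k, l} contributes 2 ^+ 2. For every other j, the factors of {k, j} and {l, j} multiply
    to at most 1 by [reldistM_opp]. *)
Lemma sqprod_remove_tie y k l S : k \in S -> l \in S -> y k != 0 -> y l = - y k ->
  sqprod y S <= 4 * sqprod y (S :\ k :\ l).
Proof.
move=> kS lS yk0 ylk.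
have lk : l != k by apply: contraNneq yk0 => E; move: ylk; rewrite E; lra.
have lSk : l \in S :\ k by rewrite !inE lk.
rewrite -{1}(setD1K kS) sqprodU1 ?setD11 // -{1 2}(setD1K lSk).
rewrite sqprodU1 ?setD11 // big_setU1 ?setD11 //=.
set S' := _ :\ l.
rewrite {1}/pair_factor eq_sym (negbTE lk) ylk reldist_opp //.
set K := \prod_(j in S') pair_factor y k j; set L := \prod_(j in S') _.
have KL_ge0 : 0 <= K * L.
  by rewrite mulr_ge0 // prodr_ge0 // => j _; exact: pair_factor_ge0.
have KL_le1 : K * L <= 1.
  rewrite -big_split /= prodr_ile1 // => j.
  rewrite !inE => /and3P[jl jk _].
  rewrite mulr_ge0 ?pair_factor_ge0 //= /pair_factor.
  rewrite eq_sym (negbTE jk) eq_sym (negbTE jl) ylk.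
  by rewrite reldistC [reldist (- _) _]reldistC reldistM_opp.
rewrite [leLHS](_ : _ = 4 * ((K * L) ^+ 2 * sqprod y S')); last by ring.
by rewrite ler_pM2l // ler_piMl ?sqprod_ge0 // expr_le1.
Qed.

Lemma sqprod_le1 y S : (forall i, y i != 0) ->
    {in S &, forall i j, (0 < y i) = (0 < y j)} -> sqprod y S <= 1.
Proof.
move=> y0 same; apply: prodr_ile1 => i iS; apply/andP; split.
  by apply: prodr_ge0 => j _; exact: pair_factor_ge0.
apply: prodr_ile1 => j jS; rewrite pair_factor_ge0 /pair_factor /=.
by case: ifP => // _; apply: reldist_same_sign => //; exact: same.
Qed.

(** * Moving to a tie without decreasing the product *)

Definition total_slope y S := \sum_(i in S) \sum_(j in S) slope (y i) (y j).

(** [total_slope] is the logarithmic derivative of [sqprod] at t = 0, so the pairwise bounds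
    [reldist_scale_pos_ge] multiply to this one. By the last hypothesis no pair passes its tie
    before [t]. *)
Lemma sqprod_scale_pos_ge y S (t : R) : (forall i, y i != 0) -> 0 <= t ->
    {in S &, forall i j, y i + y j != 0} ->
    {in S &, forall i j, 0 < y i -> y i + y j < 0 -> expR t * y i + y j <= 0} ->
  sqprod y S * expR (t * total_slope y S) <= sqprod (scale_pos t \o y) S.
Proof.
move=> y0 t0 notie nocross.
rewrite /total_slope mulr_sumr expR_sum -big_split /=.
apply: ler_prod => i iS; apply/andP; split.
  by rewrite mulr_ge0 ?expR_ge0 ?prodr_ge0 // => j _; exact: pair_factor_ge0.
rewrite mulr_sumr expR_sum -big_split /=.
apply: ler_prod => j jS; apply/andP; split.
  by rewrite mulr_ge0 ?expR_ge0 ?pair_factor_ge0.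
rewrite /pair_factor; case: eqP => [->|_].
  (* Diagonal factors stay 1 and have slope 0. *)
  by rewrite /slope -expr2 exprn_even_gt0 // y0 mulr0 expR0 mulr1.
apply: reldist_scale_pos_ge => //; first by move=> _; exact: notie.
  exact: nocross.
by move=> yj s; rewrite addrC; apply: nocross; rewrite // addrC.
Qed.

(** These are the pairs that reach a tie as t grows from 0, namely when [expR t] equals - y p.2 / y
    p.1. *)
Definition crossing y S (p : I * I) :=
  [&& p.1 \in S, p.2 \in S, 0 < y p.1 & y p.1 + y p.2 < 0].

(* Otherwise every slope would be nonpositive, and [slope (y k) (y l)] negative. *)
Lemma crossing_exists y S k l : k \in S -> l \in S -> 0 < y k -> y l < 0 ->
    (forall i, y i != 0) ->
    {in S &, forall i j, y i + y j != 0} -> 0 <= total_slope y S ->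
  exists p, crossing y S p.
Proof.
move=> kS lS yk yl y0 notie.
have [/existsP //|nocross] := boolP [exists p, crossing y S p].
rewrite leNgt => /negP[].
have sum_gt0 i j : i \in S -> j \in S -> y i * y j < 0 -> 0 < y i + y j.
  move=> iS jS ij; rewrite lt_neqAle eq_sym notie // leNgt; apply/negP => s.
  case/negP: nocross; apply/existsP; have [yi|yi] := ltP 0 (y i).
    by exists (i, j); rewrite /crossing iS jS yi.
  by exists (j, i); rewrite /crossing /= iS jS addrC s andbT; nra.
have slope_le0 i j : i \in S -> j \in S -> slope (y i) (y j) <= 0.
  move=> iS jS; rewrite /slope; case: ltP => // ij.
  have ij_lt0 : y i * y j < 0 by rewrite lt_neqAle mulf_neq0.
  have s := sum_gt0 _ _ iS jS ij_lt0.
  rewrite ltNge (ltW s) /= mulr_le0_ge0 ?invr_ge0 // ge_min.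
  by have [|yi] := leP (y i) 0; rewrite //=; nra.
have kl : y k * y l < 0 by nra.
have slope_kl : slope (y k) (y l) < 0.
  have s := sum_gt0 _ _ kS lS kl.
  rewrite /slope (ltNge 0) (ltW kl) /= (ltNge (_ + _)) (ltW s) /= nmulr_rlt0 ?invr_gt0 ?normr_gt0.
    by rewrite subr_eq0; apply/eqP => E; lra.
  by rewrite gt_min yl orbT.
rewrite /total_slope (bigD1 k) //= (bigD1 l) //=.
have H1 : \sum_(j in S | j != l) slope (y k) (y j) <= 0.
  by apply: sumr_le0 => j /andP[jS _]; exact: slope_le0.
have H2 : \sum_(i in S | i != k) \sum_(j in S) slope (y i) (y j) <= 0.
  by apply: sumr_le0 => i /andP[iS _]; apply: sumr_le0 => j jS; exact: slope_le0.
lra.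
Qed.

Lemma move_to_tie y S k l : k \in S -> l \in S -> 0 < y k -> y l < 0 ->
    (forall i, y i != 0) ->
    {in S &, forall i j, y i + y j != 0} -> 0 <= total_slope y S ->
  exists z : I -> R, [/\ forall i, (0 < z i) = (0 < y i), forall i, z i != 0,
    sqprod y S <= sqprod z S & exists i j, [/\ i \in S, j \in S & z i = - z j]].
Proof.
move=> kS lS yk yl y0 notie slope_ge0.
have [p0 p0_cross] := crossing_exists kS lS yk yl y0 notie slope_ge0.
(* The smallest ratio is the value of [expR t] at the first tie. *)
have [[i j] /and4P[/= iS jS yi yij] ratio_min] :=
  @arg_minP _ _ _ p0 (crossing y S) (fun p => - y p.2 / y p.1) p0_cross.
set r := - y j / y i in ratio_min.
have r_ge1 : 1 <= r by rewrite /r ler_pdivlMr // mul1r; lra.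
have r_gt0 : 0 < r by rewrite (lt_le_trans _ r_ge1).
have expr : expR (ln r) = r by rewrite lnK.
exists (scale_pos (ln r) \o y); split => [a|a||] /=.
- exact: scale_pos_gt0.
- exact: scale_pos_neq0.
- apply: le_trans (sqprod_scale_pos_ge y0 (ln_ge0 r_ge1) notie _).
    rewrite ler_peMr ?sqprod_ge0 // -expR0 ler_expR.
    by rewrite mulr_ge0 // ln_ge0.
  (* A pair overtaking before [ln r] would be a crossing of smaller ratio. *)
  move=> a b aS bS ya yab; rewrite expr.
  have := ratio_min (a, b); rewrite /crossing /= aS bS ya yab => /(_ isT).
  by rewrite ler_pdivlMr //; lra.
exists i, j; split => //; rewrite /scale_pos yi expr.
by rewrite /r divfK ?gt_eqF // ifF //; apply/negbTE; rewrite -leNgt; lra.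
Qed.

Lemma total_slope_opp y S : (forall i, y i != 0) ->
    {in S &, forall i j, y i + y j != 0} ->
  total_slope (fun i => - y i) S = - total_slope y S.
Proof.
move=> y0 notie; rewrite /total_slope -sumrN; apply: eq_bigr => i iS.
rewrite -sumrN; apply: eq_bigr => j jS.
by rewrite slopeNN ?mulf_neq0 // => _; exact: notie.
Qed.

Lemma oppr_gt0_neq0 (u : R) : u != 0 -> (0 < - u) = ~~ (0 < u).
Proof. by move=> u0; rewrite oppr_gt0 -leNgt lt_neqAle u0. Qed.

(** If a tie is already present, [y] itself serves. If the total slope is negative, [move_to_tie] is
    applied to - y: this enlarges the negative entries, which up to a common scaling is to shrink
    the positive ones. *)
Lemma move_to_tie_any y S k l : k \in S -> l \in S -> 0 < y k -> y l < 0 ->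
    (forall i, y i != 0) ->
  exists z : I -> R, [/\ forall i, (0 < z i) = (0 < y i), forall i, z i != 0,
    sqprod y S <= sqprod z S & exists i j, [/\ i \in S, j \in S & z i = - z j]].
Proof.
move=> kS lS yk yl y0.
have [/existsP[[i j] /and3P[/= iS jS /eqP yij]]|notie] :=
  boolP [exists p : I * I, [&& p.1 \in S, p.2 \in S & y p.1 + y p.2 == 0]].
  exists y; split => //; exists i, j; split => //; lra.
have {}notie : {in S &, forall i j, y i + y j != 0}.
  move=> i j iS jS; apply: contra notie => yij.
  by apply/existsP; exists (i, j); rewrite /= iS jS.
have [slope_ge0|/ltW slope_le0] := leP 0 (total_slope y S).
  exact: (move_to_tie kS lS).
have y0N i : - y i != 0 by rewrite oppr_eq0.
have notieN : {in S &, forall i j, - y i + - y j != 0}.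
  by move=> i j iS jS; rewrite -opprD oppr_eq0 notie.
have yl_gt0 : 0 < - y l by rewrite oppr_gt0.
have yk_lt0 : - y k < 0 by rewrite oppr_lt0.
have slopeN_ge0 : 0 <= total_slope (fun i => - y i) S.
  by rewrite total_slope_opp // oppr_ge0.
have [z [zy z0 yz [i [j [iS jS zij]]]]] :=
  move_to_tie lS kS yl_gt0 yk_lt0 y0N notieN slopeN_ge0.
exists (fun i => - z i); split => [a|a||].
- by rewrite oppr_gt0_neq0 // zy oppr_gt0_neq0 // negbK.
- by rewrite oppr_eq0.
- by rewrite sqprod_opp -sqprod_opp.
by exists i, j; split; rewrite // zij.
Qed.

(** * Induction on the number of indices *)

Lemma sqprod_le y S : (forall i, y i != 0) ->
  sqprod y S <= 4 ^+ minn (npos y S) (nneg y S).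
Proof.
have [n] := ubnP #|S|; elim: n y S => // n IH y S; rewrite ltnS => Sn y0.
(* When one sign is missing on [S], every factor is at most 1. *)
have [/existsP[k /andP[kS yk]]|nopos] :=
  boolP [exists k, (k \in S) && (0 < y k)]; last first.
  apply: le_trans (exprn_ege1 _ _); last by rewrite ler1n.
  apply: sqprod_le1 => // i j iS jS.
  move/existsPn: nopos => nopos.
  by have := nopos i; have := nopos j; rewrite iS jS /= => /negbTE-> /negbTE->.
have [/existsP[l /andP[lS yl]]|noneg] :=
  boolP [exists l, (l \in S) && (y l < 0)]; last first.
  apply: le_trans (exprn_ege1 _ _); last by rewrite ler1n.
  apply: sqprod_le1 => // i j iS jS.
  move/existsPn: noneg => noneg; have := noneg i; have := noneg j.
  by rewrite iS jS /= -!leNgt !lt_neqAle ![0 == _]eq_sym !y0 /= => -> ->.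
have [z [zy z0 yz tie]] := move_to_tie_any kS lS yk yl y0.
(* The tie is oriented so that [i] is its positive index. *)
have {tie} [i [j [iS jS zi zij]]] :
    exists i j, [/\ i \in S, j \in S, 0 < z i & z j = - z i].
  have [i [j [iS jS zij]]] := tie.
  have [zi|zi] := ltP 0 (z i); first by exists i, j; split => //; lra.
  exists j, i; split => //; have := z0 i.
  by rewrite lt_neqAle zij oppr_eq0 eq_sym => -> /=; lra.
have zneg a : (z a < 0) = (y a < 0).
  by rewrite -!oppr_gt0 !oppr_gt0_neq0 // zy.
have jD : j \in S :\ i.
  by rewrite !inE jS andbT; apply: contraTneq zi => E; move: zij; rewrite E -leNgt; lra.
(* The signs of [z] are those of [y], and the tied pair has one index of each sign: both counts drop
   by one, which pays for the factor 4. *)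
have -> : minn (npos y S) (nneg y S) =
    (minn (npos z (S :\ i :\ j)) (nneg z (S :\ i :\ j))).+1.
  have -> : npos y S = (npos z (S :\ i :\ j)).+1.
    rewrite /npos (cardsD1 i) inE iS -zy zi add1n; congr _.+1.
    apply: eq_card => a; rewrite !inE -zy.
    case: (a =P j) => [->|]; last by rewrite andbA.
    by rewrite zij oppr_gt0 ltNge (ltW zi) !andbF.
  have -> : nneg y S = (nneg z (S :\ i :\ j)).+1.
    rewrite /nneg (cardsD1 j) inE jS -zneg zij oppr_lt0 zi add1n; congr _.+1.
    apply: eq_card => a; rewrite !inE -zneg.
    case: (a =P i) => [->|]; last by rewrite andbA.
    by rewrite ltNge (ltW zi) !andbF.
  by rewrite minnSS.
apply: le_trans yz _; apply: le_trans (sqprod_remove_tie iS jS (z0 i) zij) _.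
rewrite exprS ler_pM2l //; apply: IH => //.
by apply: leq_trans Sn; rewrite (cardsD1 i S) iS (cardsD1 j (S :\ i)) jD; lia.
Qed.

End SquaredProduct.

(** * Back to the ordered product *)

Lemma sqprod_ord (R : realType) (N : nat) (y : 'I_N -> R) :
    (forall i : 'I_N, y i != 0) ->
    (forall i j : 'I_N, (i <= j)%N -> `|y i| <= `|y j|) ->
  sqprod y [set: 'I_N] =
    (\prod_(i < N) \prod_(j < N | (i < j)%N) `|1 - y i / y j|) ^+ 2.
Proof.
(* One copy of the product is reindexed with i and j exchanged, so that for each i the two copies
   cover the j above i and the j below i. *)
move=> y0 le_y; rewrite expr2 {2}(exchange_big_dep xpredT) //= -big_split /=.
rewrite /sqprod (eq_bigl xpredT) => [|i]; last by rewrite inE.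
apply: eq_bigr => i _; rewrite (eq_bigl xpredT) => [|j]; last by rewrite inE.
rewrite (bigID (fun j : 'I_N => (i < j)%N)) /=; congr (_ * _).
  apply: eq_bigr => j ij.
  rewrite /pair_factor ifF; last by apply/negbTE; rewrite neq_ltn ij.
  by rewrite reldist_norm_le // le_y // ltnW.
rewrite (bigD1 i) ?ltnn //= {1}/pair_factor eqxx mul1r.
apply: eq_big => [j|j /andP[ji ij]]; first by rewrite -leqNgt ltn_neqAle andbC.
by rewrite pair_factorC /pair_factor (negbTE ij) reldist_norm_le // le_y // leqNgt.
Qed.

Theorem theorem1p1 (R : realType) (N : nat) (y : 'I_N -> R)
    (N_ge1 : (1 <= N)%N)
    (y_neq0 : forall i : 'I_N, y i != 0)
    (y_norm_le : forall i j : 'I_N, (i <= j)%N -> `|y i| <= `|y j|) :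
  let p := #|[set i : 'I_N | 0 < y i]| in
  let m := #|[set i : 'I_N | y i < 0]| in
  \prod_(i < N) \prod_(j < N | (i < j)%N) `|1 - y i / y j| <= 2 ^+ minn p m
  /\
  \prod_(i < N) \prod_(j < N | (i < j)%N) `|1 - y i / y j| <= 2 ^+ (N %/ 2)%N.
Proof.
move=> p m.
have le_min :
    \prod_(i < N) \prod_(j < N | (i < j)%N) `|1 - y i / y j| <= 2 ^+ minn p m.
  (* Both sides are squared, to match [sqprod] and the powers of 4. *)
  rewrite -ler_sqr ?nnegrE ?exprn_ge0 //; last first.
    by do 2!(apply: prodr_ge0 => ? _).
  rewrite -sqprod_ord // exprAC (_ : 2 ^+ 2 = 4 :> R); last by ring.
  have -> : p = npos y [set: 'I_N] by apply: eq_card => i; rewrite !inE.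
  have -> : m = nneg y [set: 'I_N] by apply: eq_card => i; rewrite !inE.
  exact: sqprod_le.
split=> //; apply: le_trans le_min _; rewrite ler_weXn2l ?ler1n //.
(* The two index sets are disjoint, hence 2 min(p, m) <= p + m <= N. *)
have pmN : (p + m <= N)%N.
  rewrite -cardsUI [X in (_ + X)%N](_ : _ = 0%N); last first.
    by apply: eq_card0 => i; rewrite !inE; case: ltgtP.
  by rewrite addn0 -[leqRHS]card_ord max_card.
rewrite leq_divRL // muln2; lia.
Qed.
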